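(* Let $X$ be a Banach space, let $(A_m)_{m\ge 0}$ be a sequence of bounded linear operators on $X$ that admits an exponential dichotomy on $\mathbb Z_0^+=\{0,1,2,\dots\}$, and let $B$ be an admissible Banach sequence space over $\mathbb Z$. Then the system $x_{n+1}=A_nx_n$, $n\ge 0$, has the $B$-Lipschitz shadowing property.
   Context: **Admissible Banach sequence spaces.** Let $\mathcal S(\mathbb Z)$ be the set of all real sequences $\mathbf s=(s_n)_{n\in\mathbb Z}$. A linear subspace $B\subset\mathcal S(\mathbb Z)$ with a norm $\|\cdot\|_B$ is a normed sequence space if whenever $\mathbf s'\in B$ and $|s_n|\le|s_n'|$ for all $n\in\mathbb Z$, then $\mathbf s\in B$ and $\|\mathbf s\|_B\le\|\mathbf s'\|_B$. If it is complete, it is a Banach sequence space. A Banach sequence space $B$ is admissible if (1) $\chi_{\{n\}}\in B$ and $\|\chi_{\{n\}}\|_B>0$ for all $n\in\mathbb Z$ ($\chi$ denotes the characteristic function); (2) for each $\mathbf s\in B$ and $m\in\mathbb Z$ the shifted sequence $(s_{n+m})_{n\in\mathbb Z}$ belongs to $B$ and has the same norm as $\mathbf s$. It is assumed throughout that $\|\chi_{\{0\}}\|_B=1$. For a Banach space $X$, $X_B$ is the Banach space of sequences $\mathbf x=(x_n)_{n\in\mathbb Z}\subset X$ with $(\|x_n\|)_{n\in\mathbb Z}\in B$, with norm $\|\mathbf x\|_B:=\|(\|x_n\|)_{n\in\mathbb Z}\|_B$. For a one-sided sequence $\mathbf x=(x_n)_{n\ge 0}\subset X$ let $\bar{\mathbf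 x}=(\bar x_n)_{n\in\mathbb Z}$ with $\bar x_n=x_n$ for $n\ge 0$ and $\bar x_n=0$ for $n<0$. Then $X_B^+:=\{\mathbf x=(x_n)_{n\ge 0}\subset X:\bar{\mathbf x}\in X_B\}$ is a Banach space with norm $\|\mathbf x\|_B^+:=\|\bar{\mathbf x}\|_B$. **Exponential dichotomy on $\mathbb Z_0^+$.** For $m\ge n\ge 0$ set $\mathcal A(m,n)=A_{m-1}\cdots A_n$ if $m>n$ and $\mathcal A(m,m)=\mathrm{Id}$. The sequence $(A_m)_{m\ge 0}$ admits an exponential dichotomy if: (1) there are projections $P_m$, $m\ge 0$, on $X$ with $P_{m+1}A_m=A_mP_m$ for all $m\ge 0$; (2) $A_m|_{\ker P_m}\colon\ker P_m\to\ker P_{m+1}$ is invertible for all $m\ge 0$; (3) there exist $C,\lambda>0$ such that for $m,n\ge 0$, $\|\mathcal A(m,n)P_n\|\le Ce^{-\lambda(m-n)}$ if $m\ge n$ and $\|\mathcal A(m,n)(\mathrm{Id}-P_n)\|\le Ce^{-\lambda(n-m)}$ if $m\le n$, where for $m\le n$, $\mathcal A(m,n):=(\mathcal A(n,m)|_{\ker P_m})^{-1}\colon\ker P_n\to\ker P_m$. **Shadowing.** For $\delta>0$, a sequence $(y_n)_{n\ge 0}\subset X$ is a $(\delta,B)$-pseudotrajectory for $x_{n+1}=A_nx_n$, $n\ge 0$, if $(y_{n+1}-A_ny_n)_{n\ge 0}\in X_B^+$ and $\|(y_{n+1}-A_ny_n)_{n\ge 0}\|_B^+\le\delta$. The system has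 the $B$-Lipschitz shadowing property if there is $L>0$ such that for every $\varepsilon>0$, with $\delta=L\varepsilon$, for every $(\delta,B)$-pseudotrajectory $(y_n)_{n\ge 0}$ there is a sequence $(x_n)_{n\ge 0}$ with $x_{n+1}=A_nx_n$ for all $n\ge 0$, $(x_n-y_n)_{n\ge 0}\in X_B^+$ and $\|(x_n-y_n)_{n\ge 0}\|_B^+\le\varepsilon$. *)

(* Defs.v *)
From mathcomp Require Import all_boot all_order all_algebra.
From mathcomp Require Import all_classical all_reals all_analysis.

Set Implicit Arguments.
Unset Strict Implicit.
Unset Printing Implicit Defensive.

Import Order.TTheory GRing.Theory Num.Theory numFieldNormedType.Exports.

Local Open Scope classical_set_scope.
Local Open Scope ring_scope.

(* A sequence space is a set B of sequences with a function nB; only the values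
   of nB on B are constrained. *)
Record normed_seq_space (R : realType) (B : set (int -> R))
    (nB : (int -> R) -> R) : Prop := {
  nss_zero : B 0 ;
  nss_add : forall s t, B s -> B t -> B (s + t) ;
  nss_scale : forall (a : R) s, B s -> B (a *: s) ;
  nss_norm_ge0 : forall s, B s -> 0 <= nB s ;
  nss_norm_eq0 : forall s, B s -> nB s = 0 -> s = 0 ;
  nss_normZ : forall (a : R) s, B s -> nB (a *: s) = `|a| * nB s ;
  nss_normD : forall s t, B s -> B t -> nB (s + t) <= nB s + nB t ;
  nss_solid : forall s s', B s' -> (forall n, `|s n| <= `|s' n|) ->
    B s /\ nB s <= nB s' }.

Definition seq_space_complete (R : realType) (B : set (int -> R))
    (nB : (int -> R) -> R) : Prop :=
  forall u : nat -> (int -> R),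
    (forall k, B (u k)) ->
    (forall e : R, 0 < e -> exists N : nat, forall k l,
      (N <= k)%N -> (N <= l)%N -> nB (u k - u l) < e) ->
    exists2 s, B s & (fun k => nB (u k - s)) @ \oo --> (0 : R).

Record admissible_banach_seq_space (R : realType) (B : set (int -> R))
    (nB : (int -> R) -> R) : Prop := {
  abss_normed : normed_seq_space B nB ;
  abss_complete : seq_space_complete B nB ;
  abss_indic : forall n : int, B \1_[set n] /\ 0 < nB \1_[set n] ;
  abss_shift : forall s (m : int), B s ->
    B (fun n => s (n + m)) /\ nB (fun n => s (n + m)) = nB s }.

Definition XB (R : realType) (B : set (int -> R)) (X : normedModType R) :
  set (int -> X) := [set x | B (fun n => `|x n|)].

Definition XB_norm (R : realType) (nB : (int -> R) -> R) (X : normedModType R)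
  (x : int -> X) : R := nB (fun n => `|x n|).

Definition zero_ext (X : nmodType) (x : nat -> X) : int -> X :=
  fun n => match n with Posz k => x k | Negz _ => 0 end.

Definition XBplus (R : realType) (B : set (int -> R)) (X : normedModType R) :
  set (nat -> X) := [set x | XB B (zero_ext x)].

Definition XBplus_norm (R : realType) (nB : (int -> R) -> R)
  (X : normedModType R) (x : nat -> X) : R := XB_norm nB (zero_ext x).

(* Extended-real valued; intended for linear T, which need not be bundled. *)
Definition opnorm (R : realType) (X : normedModType R) (T : X -> X) : \bar R :=
  ereal_sup [set (`|T x|)%:E | x in [set x : X | `|x| <= 1]].

(* The index list is n, n+1, ..., m-1, and A n acts first. *)
Definition evol (X : Type) (A : nat -> X -> X) (m n : nat) : X -> X :=
  fun x => foldl (fun y k => A k y) x (index_iota n m).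

Definition ker_set (U V : nmodType) (f : U -> V) : set U := [set x | f x = 0].

(* For m <= n, the inverse of evol A n m : ker (P m) -> ker (P n), extended to
   a total function whose values outside ker (P n) are irrelevant. *)
Definition evol_back (X : nmodType) (A P : nat -> X -> X) (m n : nat) : X -> X :=
  'pinv_(fun=> 0) (ker_set (P m)) (evol A n m).

(* Boundedness of the projections P m is not required separately: it is the
   case m = n of the first estimate. *)
Definition exponential_dichotomy (R : realType) (X : normedModType R)
    (A : nat -> {linear X -> X}) : Prop :=
  exists P : nat -> {linear X -> X},
  [/\ forall m x, P m (P m x) = P m x,
      forall m x, P m.+1 (A m x) = A m (P m x),
      forall m, set_bij (ker_set (P m)) (ker_set (P m.+1)) (A m) &
      exists C lambda : R,
      [/\ 0 < C, 0 < lambda,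
          forall m n : nat, (n <= m)%N ->
            (opnorm (fun x => evol A m n (P n x))
              <= (C * expR (- lambda * (m - n)%:R))%:E)%E &
          forall m n : nat, (m <= n)%N ->
            (opnorm (fun x => evol_back A P m n (x - P n x))
              <= (C * expR (- lambda * (n - m)%:R))%:E)%E]].

Definition pseudotrajectory (R : realType) (B : set (int -> R))
    (nB : (int -> R) -> R) (X : normedModType R) (A : nat -> X -> X)
    (delta : R) (y : nat -> X) : Prop :=
  XBplus B (fun n => y n.+1 - A n (y n)) /\
  XBplus_norm nB (fun n => y n.+1 - A n (y n)) <= delta.

Definition lipschitz_shadowing (R : realType) (B : set (int -> R))
    (nB : (int -> R) -> R) (X : normedModType R) (A : nat -> X -> X) : Prop :=
  exists2 L : R, 0 < L &
  forall eps : R, 0 < eps ->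
  forall y : nat -> X, pseudotrajectory B nB A (L * eps) y ->
  exists x : nat -> X,
  [/\ forall n, x n.+1 = A n (x n),
      XBplus B (fun n => x n - y n) &
      XBplus_norm nB (fun n => x n - y n) <= eps].

(* Main.v *)
Require Import Defs.
From mathcomp Require Import all_boot all_order all_algebra.
From mathcomp Require Import all_classical all_reals all_analysis.
Import Order.TTheory GRing.Theory Num.Theory numFieldNormedType.Exports.
From mathcomp Require Import ring.
Local Open Scope classical_set_scope.
Local Open Scope ring_scope.

(** A pseudotrajectory [y] with error [d n = y n.+1 - A n (y n)] is corrected
    to the exact trajectory [y + z] by any solution [z] of the inhomogeneous
    equation [z n.+1 = A n (z n) - d n].  The dichotomy supplies the solution
    given by the Green function: the stable part of each error is propagated
    forwards, the unstable part backwards,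
      [z n = \sum_(j >= 0) A(n, n+j+1) (d (n+j) - P (n+j+1) (d (n+j)))
             - \sum_(k < n) A(n, k+1) P (k+1) (d k)].
    With [q = expR (- lambda)], this gives the pointwise bound
      [`|z n| <= C * (\sum_(j >= 0) q ^+ j * s (n - (j+1))
                     + \sum_(j >= 0) q ^+ j * s (n + j))],
    where [s] is the sequence of norms of the errors, extended by zero to the
    negative integers ([dichotomy_inhomogeneous]).

    The right-hand side is a sum of geometrically discounted translates of
    [s].  Translates have the norm of [s], so both series converge absolutely
    in the complete space [B], with sums of norm at most [nB s / (1 - q)]
    ([geometric_shift_sum]).  The coordinates are continuous on [B], hence
    these sums are the pointwise ones ([nss_abs_series]).  By solidity, the
    norms of [z] form an element of [B] of norm at most
    [2 * C / (1 - q) * nB s], and [(1 - q) / (2 * C)] is a shadowing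
    constant. *)

(** * Absolutely convergent series in a sequence space *)

Lemma series_lim_ge (R : realType) (a : nat -> R) (n : nat) :
  (forall j, 0 <= a j) -> cvgn (series a) -> series a n <= limn (series a).
Proof.
move=> a0 ca; apply: nondecreasing_cvgn_le ca n.
by apply/nondecreasing_seqP => k; rewrite /series /= big_nat_recr //= lerDl.
Qed.

Section SequenceSpace.
Variables (R : realType) (B : set (int -> R)) (nB : (int -> R) -> R).
Hypothesis HB : normed_seq_space B nB.

Lemma nss_norm0 : nB 0 = 0.
Proof.
by rewrite -(scale0r (0 : int -> R)) (nss_normZ HB) ?normr0 ?mul0r //; exact: (nss_zero HB).
Qed.

Lemma nss_opp s : B s -> B (- s) /\ nB (- s) = nB s.
Proof.
move=> Bs; rewrite -scaleN1r; split; first exact: (nss_scale HB).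
by rewrite (nss_normZ HB) // normrN1 mul1r.
Qed.

Lemma nss_sub s t : B s -> B t -> B (s - t).
Proof. by move=> Bs Bt; apply: (nss_add HB) => //; exact: (nss_opp _ Bt).1. Qed.

Lemma nss_sum (v : nat -> int -> R) (r : seq nat) : (forall j, B (v j)) ->
  B (\sum_(j <- r) v j) /\ nB (\sum_(j <- r) v j) <= \sum_(j <- r) nB (v j).
Proof.
move=> Bv; elim: r => [|j r [Br nr]].
  by rewrite !big_nil nss_norm0; split=> //; exact: (nss_zero HB).
rewrite !big_cons; split; first exact: (nss_add HB).
by apply: le_trans (nss_normD HB _ _) _ => //; rewrite lerD2l.
Qed.

(** Solidity makes the coordinates continuous: [s n] times the indicator of
    [n] is dominated by [s]. *)
Lemma nss_coord_le s n : B \1_[set n] -> B s ->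
  `|s n| * nB \1_[set n] <= nB s.
Proof.
move=> B1 Bs; rewrite -(nss_normZ HB) //.
suff H k : `|(s n *: \1_[set n] : int -> R) k| <= `|s k| by exact: (nss_solid HB Bs H).2.
rewrite fctE /= indicE /GRing.scale /= .
case: (boolP (k \in _)) => [/set_mem ->|_]; first by rewrite mulr1.
by rewrite mulr0 normr0.
Qed.

(** Completeness in the form in which it is used: an absolutely convergent
    series has a sum in [B].  Since the coordinates are continuous, this sum
    is the coordinatewise one, and so an explicit sequence is seen to lie in
    [B]. *)
Lemma nss_abs_series (v : nat -> int -> R) (a : nat -> R) :
  seq_space_complete B nB -> (forall n, B \1_[set n] /\ 0 < nB \1_[set n]) ->
  (forall j, B (v j)) -> (forall j, nB (v j) <= a j) -> cvgn (series a) ->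
  exists w, [/\ B w, nB w <= limn (series a) &
    forall n, series (fun j => v j n) @ \oo --> w n].
Proof.
move=> cB iB Bv va ca.
have a0 j : 0 <= a j by apply: le_trans (va j); exact: (nss_norm_ge0 HB).
have BS k : B (series v k) by exact: (nss_sum _ _ Bv).1.
have dS k l : (k <= l)%N -> nB (series v k - series v l) <= series a l - series a k.
  move=> kl; rewrite -(nss_opp (_ - _) _).2 ?opprB; last exact: nss_sub.
  rewrite !sub_series_geq //; apply: le_trans (nss_sum _ _ Bv).2 _.
  exact: ler_sum.
have [|w Bw Sw] := cB _ BS.
  move=> e e0.
  have /cvgrPdist_lt/(_ e e0)[N _ HN] := ca.
  exists N => k l; wlog kl : k l / (k <= l)%N.
    move=> H Nk Nl; have /orP[kl|kl] := leq_total k l; first exact: H.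
    rewrite -(nss_opp (_ - _) _).2 ?opprB; first exact: H.
    exact: nss_sub.
  move=> Nk _; apply: le_lt_trans (dS _ _ kl) _.
  have := HN k Nk; rewrite ger0_norm ?subr_ge0 ?series_lim_ge //.
  by apply: le_lt_trans; rewrite lerD2r series_lim_ge.
have BD k : B (series v k - w) by exact: nss_sub.
exists w; split=> //.
  (* [nB w] is at most [nB (series v k - w)] plus a partial sum of [a] *)
  have H k : nB w <= nB (series v k - w) + limn (series a).
    have -> : nB w = nB (- (series v k - w) + series v k) by rewrite opprB subrK.
    have [Bo no] := nss_opp _ (BD k).
    apply: le_trans (nss_normD HB Bo (BS k)) _; rewrite no lerD2l.
    apply: le_trans (nss_sum _ _ Bv).2 _.
    by apply: le_trans (series_lim_ge _ _ k a0 ca); exact: ler_sum.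
  have cH : (fun k => nB (series v k - w) + limn (series a)) @ \oo
      --> 0 + limn (series a) by apply: cvgD => //; exact: cvg_cst.
  rewrite add0r in cH.
  rewrite -(cvg_lim _ cH) //; apply: limr_ge; first by apply/cvg_ex; eexists; exact: cH.
  by near=> k.
move=> n; have [B1 p1] := iB n.
have -> : series (fun j => v j n) = (fun k => series v k n).
  by apply/funext => k; rewrite /series /= fct_sumE.
apply/subr_cvg0.
apply: (@squeeze_cvgr _ _ _ _ (fun k => - (nB (series v k - w) / nB \1_[set n]))
   (fun k => nB (series v k - w) / nB \1_[set n])).
- near=> k; rewrite -ler_norml ler_pdivlMr //.
  exact: nss_coord_le _ _ B1 (BD k).
- rewrite -oppr0 -(mul0r (nB \1_[set n])^-1); apply: cvgN.
  by apply: cvgMr_tmp.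
- by rewrite -(mul0r (nB \1_[set n])^-1); apply: cvgMr_tmp.
Unshelve. all: by end_near. Qed.

End SequenceSpace.

(** * Sums of translates *)

(** By translation invariance the [j]-th term
    has norm at most [q ^+ j * nB s], whatever the shift [m j]. *)
Lemma geometric_shift_sum (R : realType) (B : set (int -> R))
    (nB : (int -> R) -> R) (q : R) (m : nat -> int) (s : int -> R) :
  admissible_banach_seq_space B nB -> 0 <= q < 1 -> B s ->
  exists w, [/\ B w, nB w <= nB s / (1 - q) &
    forall n, series (fun j => q ^+ j * s (n + m j)) @ \oo --> w n].
Proof.
move=> hB /andP[q0 q1] Bs; have HB := abss_normed hB.
have nq : `|q| < 1 by rewrite ger0_norm.
pose v j : int -> R := q ^+ j *: (fun n => s (n + m j)).
have Bv j : B (v j) by exact: nss_scale HB _ _ (abss_shift hB _ Bs).1.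
have nv j : nB (v j) <= geometric (nB s) q j.
  have [Bm nm] := abss_shift hB (m j) Bs.
  by rewrite (nss_normZ HB) // nm ger0_norm ?exprn_ge0 // mulrC.
have [w [Bw nw cw]] := nss_abs_series _ _ _ HB _ _ (abss_complete hB) (abss_indic hB)
  Bv nv (is_cvg_geometric_series nq).
exists w; split=> //.
by rewrite (cvg_lim _ (cvg_geometric_series nq)) in nw.
Qed.

(** * Forward and backward evolution *)

(** Rescaling to the unit ball.  Linearity enters only as homogeneity, so that
    the bound applies to the backward evolution, which is a bare function. *)
Lemma opnorm_bound (R : realType) (X : normedModType R) (T : X -> X) (c : R) :
  (forall a x, T (a *: x) = a *: T x) -> (opnorm T <= c%:E)%E ->
  forall x, `|T x| <= c * `|x|.
Proof.
move=> TZ Tc x; have [->|x0] := eqVneq x 0.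
  by rewrite -(scale0r (0 : X)) TZ !scale0r !normr0 mulr0.
have nx : 0 < `|x| by rewrite normr_gt0.
rewrite -ler_pdivrMr //.
have -> : `|T x| / `|x| = `|T (`|x|^-1 *: x)|.
  by rewrite TZ normrZ normfV normr_id mulrC.
rewrite -lee_fin; apply: le_trans Tc; apply: ereal_sup_ubound.
by exists (`|x|^-1 *: x) => //=; rewrite normrZ normfV normr_id mulVf // gt_eqF.
Qed.

Section Evolution.
Variables (R : realType) (X : normedModType R).
Variables (A P : nat -> {linear X -> X}).

Lemma evolnn n x : evol A n n x = x.
Proof. by rewrite /evol /index_iota subnn. Qed.

Lemma evolS m n x : (n <= m)%N -> evol A m.+1 n x = A m (evol A m n x).
Proof.
by move=> nm; rewrite /evol /index_iota subSn // -addn1 iotaD foldl_cat /= subnKC.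
Qed.

Lemma evol_first m n x : (n < m)%N -> evol A m n x = evol A m n.+1 (A n x).
Proof. by move=> nm; rewrite /evol /index_iota -(subnSK nm). Qed.

Lemma evolZ m n a x : (n <= m)%N -> evol A m n (a *: x) = a *: evol A m n x.
Proof.
elim: m => [|m IH]; first by rewrite leqn0 => /eqP->; rewrite !evolnn.
rewrite leq_eqVlt => /predU1P[->|]; first by rewrite !evolnn.
by rewrite ltnS => nm; rewrite !evolS // IH // linearZ.
Qed.

Hypothesis P_idem : forall m x, P m (P m x) = P m x.
Hypothesis kerA : forall m, set_bij (ker_set (P m)) (ker_set (P m.+1)) (A m).

Lemma evol_ker_bij m n : (m <= n)%N ->
  set_bij (ker_set (P m)) (ker_set (P n)) (evol A n m).
Proof.
have base k : set_bij (ker_set (P k)) (ker_set (P k)) (evol A k k).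
  have -> : evol A k k = id by apply/funext => x; rewrite evolnn.
  by split=> // x kx; exists x.
elim: n => [|n IH]; first by rewrite leqn0 => /eqP->.
rewrite leq_eqVlt => /predU1P[->//|]; rewrite ltnS => mn.
have -> : evol A n.+1 m = A n \o evol A n m by apply/funext => x; rewrite evolS.
exact: set_bij_comp (IH mn) (kerA n).
Qed.

Lemma evol_backK m n v : (m <= n)%N -> P n v = 0 ->
  P m (evol_back A P m n v) = 0 /\ evol A n m (evol_back A P m n v) = v.
Proof.
move=> mn Pv; have [_ _ S] := evol_ker_bij _ _ mn.
split; last by apply: pinvK; apply/mem_set; exact: S.
by apply: (surjpinv_image_sub S); exists v.
Qed.

Lemma evol_back_eq m n v x : (m <= n)%N -> P m x = 0 -> evol A n m x = v ->
  evol_back A P m n v = x.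
Proof.
move=> mn Px <-; have [_ I _] := evol_ker_bij _ _ mn.
by apply: (pinvKV _ I); apply/mem_set.
Qed.

(** Both sides lie in the kernel of [P m.+1] and are carried to [v] by the
    evolution from [m.+1] to [n], which is injective there. *)
Lemma evol_back_step m n v : (m < n)%N -> P n v = 0 ->
  A m (evol_back A P m n v) = evol_back A P m.+1 n v.
Proof.
move=> mn Pv; have [Pb Eb] := evol_backK _ _ _ (ltnW mn) Pv.
apply/esym/evol_back_eq => //; last by rewrite -evol_first.
by have [F _ _] := kerA m; exact: F.
Qed.

Lemma evol_backZ m n a v : (m <= n)%N -> P n v = 0 ->
  evol_back A P m n (a *: v) = a *: evol_back A P m n v.
Proof.
move=> mn Pv; have [Pb Eb] := evol_backK _ _ _ mn Pv.
by apply: evol_back_eq => //; [rewrite linearZ /= Pb scaler0|rewrite evolZ // Eb].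
Qed.

Lemma ker_compl m x : P m (x - P m x) = 0.
Proof. by rewrite linearB /= P_idem subrr. Qed.

End Evolution.

(** * The inhomogeneous equation *)

(** The solution is [t n - r n], where [t] collects the unstable parts of the
    errors still to come and [r] the stable parts of the past errors.  The sum
    [r] is finite and obeys its recurrence at once.  For [t], the operator
    [A n] turns the series at [n] into the series at [n.+1] with one more term
    in front, and the boundedness of [A n] lets it pass through the limit.
    The convergence of the majorant [v] is what makes the series [t]
    converge. *)
Lemma dichotomy_inhomogeneous (R : realType) (X : completeNormedModType R)
    (A : nat -> {linear X -> X}) :
  (forall m, bounded_near (A m) (nbhs (0 : X))) -> exponential_dichotomy A ->
  exists C q : R, [/\ 0 < C, 0 <= q < 1 &
    forall (d : nat -> X) (u v : nat -> R),
    (forall n : nat, series (fun j => q ^+ j * `|zero_ext d (n%:Z - j.+1%:Z)|) @ \oo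
      --> u n) ->
    (forall n : nat, series (fun j => q ^+ j * `|zero_ext d (n%:Z + j%:Z)|) @ \oo
      --> v n) ->
    exists z : nat -> X, (forall n, z n.+1 = A n (z n) - d n) /\
      forall n, `|z n| <= C * (u n + v n)].
Proof.
move=> bA [P [Pid PA kerA [C [lambda [C0 l0 Hs Hu]]]]].
pose q := expR (- lambda).
have q1 : q < 1 by rewrite expR_lt1 oppr_lt0.
have q0 : 0 <= q by exact: expR_ge0.
have qE k : expR (- lambda * k%:R) = q ^+ k by rewrite expRM_natr.
have Bs m n x : (n <= m)%N -> `|evol A m n (P n x)| <= C * q ^+ (m - n) * `|x|.
  move=> nm; rewrite -qE; apply: (opnorm_bound _ _ (fun x => _) _ _ (Hs m n nm)).
  by move=> a y; rewrite linearZ /= evolZ.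
have Bu m n x : (m <= n)%N ->
    `|evol_back A P m n (x - P n x)| <= C * q ^+ (n - m) * `|x|.
  move=> nm; rewrite -qE; apply: (opnorm_bound _ _ (fun x => _) _ _ (Hu m n nm)).
  move=> a y; rewrite linearZ /= -scalerBr evol_backZ //; exact: ker_compl.
exists C, q; split=> //; first by rewrite q0.
move=> d u v cu cv.
pose r n := \sum_(0 <= k < n) evol A n k.+1 (P k.+1 (d k)).
pose f n j := evol_back A P n (n + j).+1 (d (n + j)%N - P (n + j).+1 (d (n + j)%N)).
pose t n := limn (series (f n)).
have rS n : r n.+1 = A n (r n) + P n.+1 (d n).
  rewrite /r big_nat_recr //= evolnn linear_sum; congr (_ + _).
  rewrite big_nat_cond [RHS]big_nat_cond.
  by apply: eq_bigr => k /andP[/andP[_ kn] _]; rewrite evolS.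
(* summed in reverse order, the forward estimates are the first [n] terms of
   the series with sum [u n] *)
have r_le n : `|r n| <= C * u n.
  apply: le_trans (ler_norm_sum _ _ _) _.
  apply: (@le_trans _ _ (C * series (fun j => q ^+ j * `|zero_ext d (n%:Z - j.+1%:Z)|) n)).
    rewrite big_nat_rev /= add0n /series /= mulr_sumr !big_nat; apply: ler_sum => j /= jn.
    rewrite subzn // mulrA; apply: le_trans (Bs _ _ _ _) _; first by rewrite subnSK ?leq_subr.
    by rewrite subnSK // subKn // ltnW.
  rewrite ler_pM2l // -(cvg_lim _ (cu n)) //; apply: series_lim_ge.
    by move=> j; rewrite mulr_ge0 // exprn_ge0.
  by apply/cvg_ex; eexists; exact: cu.
have f_le n j : `|f n j| <= C * (q ^+ j * `|zero_ext d (n%:Z + j%:Z)|).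
  apply: le_trans (Bu _ _ _ _) _; first by rewrite leqW // leq_addr.
  (* the estimate has [q ^+ j.+1]; the exponent is lowered so as to match a
     translate of the errors by [j] *)
  rewrite mulrA ler_wpM2r // ler_pM2l // -addnS addKn exprS.
  by rewrite ler_piMl ?exprn_ge0 // ltW.
have cCv n : series (fun j => C * (q ^+ j * `|zero_ext d (n%:Z + j%:Z)|)) @ \oo --> C * v n.
  have -> : series (fun j => C * (q ^+ j * `|zero_ext d (n%:Z + j%:Z)|))
    = (fun k => C * series (fun j => q ^+ j * `|zero_ext d (n%:Z + j%:Z)|) k).
    by apply/funext => k; rewrite /series /= mulr_sumr.
  exact: cvgMl_tmp.
have iCv n : cvgn (series (fun j => C * (q ^+ j * `|zero_ext d (n%:Z + j%:Z)|))).
  by apply/cvg_ex; eexists; exact: cCv.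
have nf n : cvgn [normed series (f n)].
  apply: (series_le_cvg _ _ (f_le n)) => [j|j|]; [exact: normr_ge0| |exact: iCv].
  by apply: mulr_ge0; [exact: ltW|rewrite mulr_ge0 // exprn_ge0].
have cf n : series (f n) @ \oo --> t n by exact: normed_cvg.
have t_le n : `|t n| <= C * v n.
  rewrite -(cvg_lim _ (cCv n)) //; apply: le_trans (lim_series_norm (nf n)) _.
  exact: (lim_series_le (nf n) _ (f_le n)).
have tS n : A n (t n) = (d n - P n.+1 (d n)) + t n.+1.
  have cA : (fun k => A n (series (f n) k)) @ \oo --> A n (t n).
    have cAn : {for t n, continuous (A n)} by exact: bounded_linear_continuous (bA n) _.
    exact: cvg_comp (cf n) cAn.
  rewrite -cvg_shiftS in cA.
  apply: (cvg_unique _ cA); first exact: norm_hausdorff.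
  have -> : [sequence A n (series (f n) k.+1)]_k
      = (fun k => (d n - P n.+1 (d n)) + series (f n.+1) k).
    apply/funext => k; rewrite /series /= big_nat_recl // linearD linear_sum /=.
    congr (_ + _).
      rewrite /f addn0 evol_back_step //; last exact: ker_compl.
      by apply: evol_back_eq; rewrite ?evolnn //; exact: ker_compl.
    apply: eq_bigr => j _; rewrite /f evol_back_step ?addSnnS //; last exact: ker_compl.
    by rewrite ltnS leq_addr.
  by apply: cvgD => //; exact: cvg_cst.
exists (fun n => t n - r n); split=> [n|n].
  by rewrite linearB /= tS rS opprD addrA addrAC [RHS]addrC !addrA addNr
    add0r [in RHS](addrC (- _)).
apply: le_trans (ler_normB _ _) _.
by rewrite mulrDr addrC lerD.
Qed.

Theorem corollary2 (R : realType) (X : completeNormedModType R)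
    (A : nat -> {linear X -> X})
    (A_bounded : forall m : nat, bounded_near (A m) (nbhs (0 : X)))
    (A_dichotomy : exponential_dichotomy A)
    (B : set (int -> R)) (nB : (int -> R) -> R)
    (B_admissible : admissible_banach_seq_space B nB)
    (B_normalized : nB \1_[set (0 : int)] = 1) :
  lipschitz_shadowing B nB A.
Proof.
have [C [q [C0 q01 Hinh]]] := dichotomy_inhomogeneous _ _ _ A_bounded A_dichotomy.
have q1 : 0 < 1 - q by rewrite subr_gt0; case/andP: q01.
have HB := abss_normed B_admissible.
(* the inverse of the norm bound [C * (2 / (1 - q))] of the Green operator *)
exists ((1 - q) / (C * 2)); first by rewrite divr_gt0 // mulr_gt0.
move=> eps eps0 y [].
set d := fun n => y n.+1 - A n (y n).
rewrite /XBplus /XB /XBplus_norm /XB_norm /=.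
set s := fun n => `|zero_ext d n| => Bs ns.
have [u [Bu nu cu]] :=
  geometric_shift_sum _ _ _ _ (fun j => - j.+1%:Z) _ B_admissible q01 Bs.
have [v [Bv nv cv]] :=
  geometric_shift_sum _ _ _ _ (fun j => j%:Z) _ B_admissible q01 Bs.
have [z [zS z_le]] := Hinh d _ _ (fun n => cu n%:Z) (fun n => cv n%:Z).
have Bw : B (C *: (u + v)) by apply: (nss_scale HB); exact: (nss_add HB).
have [n|Bz nz] := nss_solid HB (s := fun n => `|zero_ext z n|) Bw.
  rewrite normr_id; case: n => n /=; last by rewrite normr0.
  exact: le_trans (z_le n) (ler_norm _).
have zE : (fun n => y n + z n - y n) = z.
  by apply/funext => n; rewrite addrAC subrr add0r.
exists (fun n => y n + z n); rewrite /XBplus_norm /XB_norm /= zE; split=> //.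
  by move=> n; rewrite zS [RHS]linearD /d /= opprB addrC addrA subrK addrC.
apply: (le_trans nz); rewrite (nss_normZ HB); last exact: (nss_add HB).
rewrite gtr0_norm // mulrC -ler_pdivlMr //.
apply: le_trans (nss_normD HB Bu Bv) _; apply: le_trans (lerD nu nv) _.
rewrite -mulrDl ler_pdivrMr //; apply: le_trans (lerD ns ns) _.
rewrite -mulr2n le_eqVlt; apply/orP; left; apply/eqP; field.
by rewrite gt_eqF.
Qed.
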